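(* Let $\mathbf{G}(s)=C(sI-A)^{-1}B$ be the transfer function of a minimal strictly proper LTI plant, let $\mathbf{K}$ be a dynamic controller that internally stabilizes $\mathbf{G}$, and let $\mathbf{K}_r$ be another dynamic controller. Denote $\mathbf{\Delta}:=\mathbf{K}_r-\mathbf{K}$. If $\mathbf{\Delta}(I-\mathbf{G}\mathbf{K})^{-1}$ is stable and $$\max\left\{\left\|(I-\mathbf{G}\mathbf{K})^{-1}\mathbf{G}\mathbf{\Delta}\right\|_{\mathcal{H}_\infty},\ \left\|\mathbf{\Delta}(I-\mathbf{G}\mathbf{K})^{-1}\mathbf{G}\right\|_{\mathcal{H}_\infty}\right\}<1,$$ then $\mathbf{K}_r$ also internally stabilizes $\mathbf{G}$.
   Context: Plant: $\dot x=Ax+Bu+Bw$, $y=Cx+v$, with real matrices, $x(t)\in\mathbb{R}^{n_x}$, $u(t),w(t)\in\mathbb{R}^m$, $y(t),v(t)\in\mathbb{R}^p$; the plant is minimal, i.e. $(A,B)$ is controllable and $(C,A)$ is observable. Its transfer function is $\mathbf{G}(s)=C(sI-A)^{-1}B$. Dynamic controller: $\dot\xi=A_K\xi+B_Ky$, $u=C_K\xi$, with $\xi(t)\in\mathbb{R}^q$ and real matrices $A_K,B_K,C_K$; it is identified with the (strictly proper, real-rational) transfer function $\mathbf{K}(s)=C_K(sI-A_K)^{-1}B_K$, represented by a minimal realization. Note the feedback sign convention $\mathbf{u}=\mathbf{K}\mathbf{y}$. Different controllers may have different orders $q$. A controller $\mathbf{K}$ internally stabilizes $\mathbf{G}$ if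 the closed-loop matrix $\begin{bmatrix}A & BC_K\\ B_KC & A_K\end{bmatrix}$ has all eigenvalues in the open left-half plane; equivalently, if the four transfer matrices $(I-\mathbf{G}\mathbf{K})^{-1}\mathbf{G}$, $(I-\mathbf{G}\mathbf{K})^{-1}\mathbf{G}\mathbf{K}$, $\mathbf{K}(I-\mathbf{G}\mathbf{K})^{-1}\mathbf{G}$, $\mathbf{K}(I-\mathbf{G}\mathbf{K})^{-1}$ all belong to $\mathcal{RH}_\infty$. $\mathcal{RH}_\infty$ is the set of real-rational proper transfer matrices all of whose poles lie in the open left-half plane; ''stable'' means belonging to $\mathcal{RH}_\infty$. For a stable transfer matrix $\mathbf{F}$, $\|\mathbf{F}\|_{\mathcal{H}_\infty}=\sup_{\omega\in\mathbb{R}}\sigma_{\max}(\mathbf{F}(j\omega))$, where $\sigma_{\max}$ is the largest singular value. Only stable transfer matrices have finite $\mathcal{H}_\infty$ norm, so a bound on an $\mathcal{H}_\infty$ norm includes the assertion that the transfer matrix is stable. *)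

(* Defs.v *)
From HB Require Import structures.
From mathcomp Require Import all_boot all_order all_algebra.
From mathcomp Require Import boolp classical_sets reals constructive_ereal ereal.
From mathcomp Require Import complex.

Set Implicit Arguments.
Unset Strict Implicit.
Unset Printing Implicit Defensive.

Import Order.TTheory GRing.Theory Num.Theory.

Local Open Scope ring_scope.
Local Open Scope sesquilinear_scope.

(* Controllability and observability of a matrix pair are the Kalman rank
   conditions. *)
Section StateSpace.
Variables (R : realType) (n m p : nat).

Definition controllable (A : 'M[R]_n) (B : 'M[R]_(n, m)) : Prop :=
  \rank (\mxrow_(i < n) (A ^+ i *m B)) = n.

Definition observable (C : 'M[R]_(p, n)) (A : 'M[R]_n) : Prop :=
  \rank (\mxcol_(i < n) (C *m A ^+ i)) = n.

Definition minimal_realization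
    (A : 'M[R]_n) (B : 'M[R]_(n, m)) (C : 'M[R]_(p, n)) : Prop :=
  controllable A B /\ observable C A.

Definition hurwitz (M : 'M[R]_n) : Prop :=
  forall z : R[i], eigenvalue (map_mx (real_complex R) M) z -> complex.Re z < 0.

End StateSpace.

(* Positive feedback interconnection u = K y. *)
Definition internally_stabilizes (R : realType) (n m p q : nat)
    (AK : 'M[R]_q) (BK : 'M[R]_(q, p)) (CK : 'M[R]_(m, q))
    (A : 'M[R]_n) (B : 'M[R]_(n, m)) (C : 'M[R]_(p, n)) : Prop :=
  hurwitz (block_mx A (B *m CK) (BK *m C) AK).

Notation ratfun R := {fraction {poly R}}.
Notation poly_ratfun R := (@FracField.tofrac {poly R}).

Section RationalFunctions.
Variable R : realType.

(* [repr f] is an arbitrary representative of f, hence the reduction to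
   lowest terms. *)
Definition rfnum (f : ratfun R) : {poly R} :=
  \n_(repr f) %/ gcdp \n_(repr f) \d_(repr f).

Definition rfden (f : ratfun R) : {poly R} :=
  \d_(repr f) %/ gcdp \n_(repr f) \d_(repr f).

Definition rfproper (f : ratfun R) : bool :=
  (size (rfnum f) <= size (rfden f))%N.

Definition rfpole (f : ratfun R) (z : R[i]) : bool :=
  root (map_poly (real_complex R) (rfden f)) z.

(* The value f(z), meaningful when z is not a pole of f. *)
Definition rfeval (z : R[i]) (f : ratfun R) : R[i] :=
  (map_poly (real_complex R) (rfnum f)).[z] /
  (map_poly (real_complex R) (rfden f)).[z].

End RationalFunctions.

Section TransferMatrices.
Variable R : realType.

Definition ratmx_of m n (M : 'M[R]_(m, n)) : 'M[ratfun R]_(m, n) :=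
  map_mx (poly_ratfun R \o polyC) M.

(* C (sI - A)^-1 B; [char_poly_mx A] is the polynomial matrix sI - A,
   whose determinant is monic, so that [invmx] is a genuine inverse. *)
Definition transfer n m p (A : 'M[R]_n) (B : 'M[R]_(n, m)) (C : 'M[R]_(p, n)) :
    'M[ratfun R]_(p, m) :=
  ratmx_of C *m invmx (map_mx (poly_ratfun R) (char_poly_mx A))
    *m ratmx_of B.

Definition RHinf m n (F : 'M[ratfun R]_(m, n)) : Prop :=
  forall i j, rfproper (F i j) /\
    (forall z : R[i], rfpole (F i j) z -> complex.Re z < 0).

Definition singular_values m n (M : 'M[R[i]]_(m, n)) : set R :=
  [set s : R | 0 <= s /\ eigenvalue (M^t* *m M) ((s ^+ 2)%:C)%C].

(* The set of singular values is finite, so [sup] is a maximum; it is 0 when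
   the set is empty, i.e. when M has no columns. *)
Definition sigma_max m n (M : 'M[R[i]]_(m, n)) : R := sup (singular_values M).

(* +oo outside RHinf: a finite bound on the norm asserts stability. *)
Definition Hinf_norm m n (F : 'M[ratfun R]_(m, n)) : \bar R :=
  if `[< RHinf F >] then
    ereal_sup [set (sigma_max (map_mx (rfeval (0 +i* w)%C) F))%:E |
                w in [set: R]]
  else +oo%E.

End TransferMatrices.

(* Main.v *)
From HB Require Import structures.
Require Import Defs.
From mathcomp Require Import all_boot all_order all_algebra.
From mathcomp Require Import boolp classical_sets reals constructive_ereal ereal.
From mathcomp Require Import complex.
From mathcomp Require Import ring lra.

Set Implicit Arguments.
Unset Strict Implicit.
Unset Printing Implicit Defensive.

Import Order.TTheory GRing.Theory Num.Theory.

Local Open Scope ring_scope.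
Local Open Scope sesquilinear_scope.

(** The closed loop is stable exactly when certain transfer matrices have all
    their poles in the open left half-plane, and those of [Kr] can be computed
    from those of [K].  Write [S = (I - G K)^-1] and [W = (I - G Kr)^-1].
    Multiplying [I - G K = (I - G Kr) + G Delta] by [S] and [W] gives
    [W = S + S G Delta W], so [E = Delta W] solves
    [(I - Delta S G) E = Delta S].  Hence, with [Y = (I - Delta S G)^-1],
      [E = Y Delta S],  [W = S + S G E],  [Kr W = K S + K S G E + E],
    and multiplying by [G] on the right gives [W G] and [Kr W G]
    ([perturbed_loop]).  Everything on the right is stable: [S G], [S],
    [K S G], [K S] because [K] stabilizes [G], [Delta S] and [Delta S G] by
    assumption, and [Y] by the small-gain argument below.

    Small gain ([small_gain]).  If [I - F(s)] were singular at some [s] with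
    nonnegative real part, say [F(s) v = v], then the scalar rational function
    [v^* F v / v^* v] would take the value 1 at [s], although it is proper,
    has its poles in the open left half-plane, and is bounded on the imaginary
    axis by the largest singular value of [F]
    ([numerical_range_le_sigma_max]), hence by some [g < 1].  This contradicts
    the maximum modulus principle on the right half-plane.

    Maximum modulus ([half_plane_max_modulus]).  A Moebius map sending [s] to
    0 carries the right half-plane to the unit disc and reduces the claim to
    a quotient [n / d] with [d = prod (1 - b z)], all [|b| < 1]
    ([disc_max_modulus]).  A bound for a polynomial on the circle holds at 0
    too, because averaging over [z] and [-z] repeatedly halves the degree
    ([poly_at0_le_circle]).  Multiply [n] by the truncated geometric series
    [q = prod (sum_(j < L) (b z)^j)], a polynomial approximation of [1/d]:
    then [d q = prod (1 - (b z)^L)] is nearly 1 on the circle, and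
    [(n q)(0) = n(0)], so [|n(0)| <= g (1 + e)] for every [e > 0].

    From transfer matrices to the closed-loop state matrix
    ([lhp_internally_stabilizes]).  Let [Phi] be the resolvent of that matrix.
    The four transfer matrices are the blocks of [Phi] compressed by the input
    and output matrices.  The rational functions without poles in the closed
    right half-plane form a ring that contains [s] and the constants.
    Observability writes the identity as a combination of the [C A^i], and
    [A X = s X - (sI - A) X] propagates membership in this ring from [C X] to
    all the [C A^i X]; so the output matrices can be cancelled, and dually the
    input matrices by controllability.  Then [Phi] lies in the ring, hence so
    does its determinant, the inverse of the characteristic polynomial, which
    therefore has no root in the closed right half-plane. *)

(** * Maximum modulus for rational functions on the unit disc *)

Section DiscMaximumModulus.

(** The mean of [p] at the two square roots of [w] is a polynomial in [w] with
    the same value at 0 and half the degree.  The excluded point 1, the image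
    of the point at infinity of the imaginary axis under the Moebius map used
    later, does no harm: neither square root of [w != 1] is 1. *)
Lemma poly_at0_le_circle (C : numClosedFieldType) (p : {poly C}) (c : C) :
  (forall z, `|z| = 1 -> z != 1 -> `|p.[z]| <= c) -> `|p.[0]| <= c.
Proof.
have [k] := ubnP (size p); elim: k p => // k IH p lt_p_k p_le.
have [p_const|p_nconst] := leqP (size p) 1.
  have N1 : `|-1 : C| = 1 by rewrite normrN1.
  have N1_neq1 : -1 != 1 :> C.
    by rewrite -subr_eq0 -opprD oppr_eq0 -(natrD _ 1 1) pnatr_eq0.
  by have := p_le _ N1 N1_neq1; rewrite (size1_polyC p_const) !hornerC.
have parts z : p.[z] = (even_poly p).[z ^+ 2] + (odd_poly p).[z ^+ 2] * z.
  by rewrite -{1}(poly_even_odd p) hornerD hornerM !horner_comp hornerX hornerXn.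
have -> : p.[0] = (even_poly p).[0] by rewrite parts expr0n mulr0 addr0.
apply: IH => [|w w1 w_neq1].
  rewrite -ltnS (leq_trans _ lt_p_k) // ltnS.
  apply: leq_ltn_trans (size_even_poly _) _.
  case: (size p) p_nconst => [|[|n]] // _; rewrite !ltnS.
  by rewrite (leq_uphalf_double n n) -addnn leq_addr.
have zE := sqrtCK w; set z := sqrtC w in zE.
have z1 : `|z| = 1.
  by apply/eqP; rewrite -(@pexpr_eq1 _ _ 2) // -normrX zE w1.
have [z_neq1 Nz_neq1] : z != 1 /\ - z != 1.
  split; apply: contra w_neq1 => /eqP zz; first by rewrite -zE zz expr1n.
  by rewrite -zE -sqrrN zz expr1n.
have : `|p.[z] + p.[- z]| <= c + c.
  by apply: le_trans (ler_normD _ _) _; rewrite lerD ?p_le ?normrN.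
rewrite !parts sqrrN zE mulrN addrACA subrr addr0 -!mulr2n normrMn.
by rewrite ler_pMn2r.
Qed.

Variable R : realType.

Lemma pow_eventually_le (x e : R) : 0 <= x < 1 -> 0 < e ->
  exists L0, forall L, (L0 <= L)%N -> x ^+ L <= e.
Proof.
move=> /andP[]; rewrite le_eqVlt => /orP[/eqP <- _|x_gt0 x_lt1] e_gt0.
  by exists 1%N => -[|L] //= _; rewrite expr0n ltW.
pose t := x^-1 - 1.
have t_gt0 : 0 < t by rewrite subr_gt0 invf_gt1.
exists (Num.bound (e * t)^-1) => L leL.
have bernoulli : L%:R * t <= (x ^+ L)^-1.
  rewrite -exprVn (_ : x^-1 = 1 + t); last by rewrite addrC subrK.
  elim: L {leL} => [|L IH]; first by rewrite mul0r expr0.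
  rewrite exprS mulrDl mul1r -natr1 mulrDl mul1r.
  apply: lerD => //; apply: ler_peMr; first exact: ltW.
  by apply: exprn_ege1; rewrite lerDl ltW.
have xL_gt0 : 0 < x ^+ L by rewrite exprn_gt0.
rewrite -(lef_pV2 _ _) ?posrE //; apply: le_trans bernoulli.
rewrite -ler_pdivrMr // -invfM; apply: le_trans (ltW (archi_boundP _)) _.
  by rewrite invr_ge0 mulr_ge0 // ltW.
by rewrite ler_nat.
Qed.

Lemma prod_pow_eventually_le (xs : seq R) (e : R) :
  all (fun x => 0 <= x < 1) xs -> 0 < e ->
  exists L0, forall L, (L0 <= L)%N -> \prod_(x <- xs) (1 + x ^+ L) <= 1 + e.
Proof.
elim: xs e => [|x xs IH] e /= => [_ e_gt0|/andP[x01 xs01] e_gt0].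
  by exists 0%N => L _; rewrite big_nil lerDl ltW.
(* with 3 d <= 1 and 3 d <= e, (1 + d)^2 <= 1 + 3 d <= 1 + e *)
pose d := Num.min 1 e / 3.
have m_gt0 : 0 < Num.min 1 e by rewrite lt_min ltr01.
have d_gt0 : 0 < d by rewrite divr_gt0.
have d_le : 3 * d <= 1 /\ 3 * d <= e.
  by rewrite /d mulrC divfK ?pnatr_eq0 // !ge_min !lexx ?orbT.
have [L1 P1] := pow_eventually_le x01 d_gt0.
have [L2 P2] := IH d xs01 d_gt0.
exists (maxn L1 L2) => L; rewrite geq_max big_cons => /andP[/P1 le1 /P2 le2].
have x_ge0 : 0 <= x ^+ L by rewrite exprn_ge0 //; case/andP: x01.
apply: (@le_trans _ _ ((1 + d) * (1 + d))); last by case: d_le; nra.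
apply: ler_pM => //; last by rewrite lerD2l.
  by rewrite addr_ge0.
rewrite big_seq prodr_ge0 // => y /(allP xs01)/andP[y_ge0 _].
by rewrite addr_ge0 // exprn_ge0.
Qed.

(** The exponent is kept positive because the geometric sums of length [L.+1]
    that it comes from must have constant term 1. *)
Lemma prod_norm_pow_eventually_le (bs : seq R[i]) (e : R) :
  all (fun b => `|b| < 1) bs -> 0 < e ->
  exists L, \prod_(b <- bs) (1 + `|b| ^+ L.+1) <= ((1 + e)%:C)%C.
Proof.
move=> bs_lt1 e_gt0; pose xs := [seq complex.Re `|b| | b <- bs].
have xE (b : R[i]) : `|b| = ((complex.Re `|b|)%:C)%C by rewrite normc_def.
have xs01 : all (fun x => 0 <= x < 1) xs.
  apply/allP => _ /mapP[b b_bs ->]; have := allP bs_lt1 b b_bs.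
  have := normr_ge0 b; rewrite (xE b) -[0]/((0%:C)%C) -[1]/((1%:C)%C).
  by rewrite lecR ltcR /= => -> ->.
have [L0 /(_ L0.+1 (leqnSn _))] := prod_pow_eventually_le xs01 e_gt0.
rewrite big_map => le_e; exists L0.
rewrite (_ : \prod_(b <- bs) _ =
  ((\prod_(b <- bs) (1 + complex.Re `|b| ^+ L0.+1))%:C)%C) ?lecR //.
rewrite (rmorph_prod (real_complex R)); apply: eq_bigr => b _.
by rewrite rmorphD rmorph1 rmorphXn [in LHS]xE.
Qed.

(** The polynomial [q] below is a truncated geometric expansion of the inverse
    of the denominator; [n q] is a polynomial, so the mean value bound applies
    to it, and the error factor [prod (1 - (b z)^L)] tends uniformly to 1. *)
Theorem disc_max_modulus (n : {poly R[i]}) (bs : seq R[i]) (g : R) :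
  0 <= g -> all (fun b => `|b| < 1) bs ->
  (forall z, `|z| = 1 -> z != 1 ->
     `|n.[z]| <= (g%:C)%C * `|\prod_(b <- bs) (1 - b * z)|) ->
  `|n.[0]| <= (g%:C)%C.
Proof.
move=> g_ge0 bs_lt1 n_le.
suff main e : 0 < e -> `|n.[0]| <= ((g * (1 + e))%:C)%C.
  have xE : `|n.[0]| = ((complex.Re `|n.[0]|)%:C)%C by rewrite normc_def.
  rewrite xE lecR; apply/ler_addgt0Pr => d d_gt0.
  (* g + 1 instead of g, which may vanish *)
  have e_gt0 : 0 < d / (g + 1) by rewrite divr_gt0 // ltr_wpDl.
  have := main _ e_gt0; rewrite xE lecR => /le_trans; apply.
  rewrite mulrDr mulr1 lerD2l mulrCA ger_pMr //.
  by rewrite ler_pdivrMr ?mul1r ?ltr_wpDl // lerDl.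
move=> e_gt0; have [L prod_le] := prod_norm_pow_eventually_le bs_lt1 e_gt0.
pose q : {poly R[i]} := \prod_(b <- bs) \sum_(j < L.+1) (b *: 'X) ^+ j.
have qE z : (\prod_(b <- bs) (1 - b * z)) * q.[z] =
    \prod_(b <- bs) (1 - (b * z) ^+ L.+1).
  rewrite horner_prod -big_split /=; apply: eq_bigr => b _.
  rewrite -[1 - (b * z) ^+ L.+1]opprB subrX1 -[RHS]mulNr opprB horner_sum.
  by congr (_ * _); apply: eq_bigr => j _; rewrite !hornerE.
have q_le z : `|z| = 1 -> z != 1 -> `|(n * q).[z]| <= ((g * (1 + e))%:C)%C.
  move=> z1 zN1; rewrite hornerM normrM.
  apply: le_trans (ler_wpM2r (normr_ge0 _) (n_le z z1 zN1)) _.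
  rewrite -mulrA -normrM qE rmorphM.
  apply: ler_wpM2l; first by rewrite lecR.
  apply: le_trans prod_le; rewrite normr_prod; apply: ler_prod => b _.
  rewrite normr_ge0 /=; apply: le_trans (ler_normB _ _) _.
  by rewrite normr1 normrX normrM z1 mulr1.
have := poly_at0_le_circle q_le.
rewrite hornerM (_ : q.[0] = 1) ?mulr1 //.
have := qE 0; rewrite !big1 ?mul1r // => b _; rewrite mulr0 ?subr0 //.
by rewrite expr0n subr0.
Qed.

End DiscMaximumModulus.

(** * Maximum modulus on the right half-plane *)

Section HalfPlaneMaximumModulus.
Variable R : realType.
Local Notation RtoC := (real_complex R).
Local Notation Re := complex.Re.
Local Notation Im := complex.Im.

(** The left half-plane consists of the points closer to [-u^*] than to [u];
    this puts the poles outside the closed unit disc after the Moebius map. *)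
Lemma lhp_reflection_lt (u a : R[i]) : 0 < Re u -> Re a < 0 ->
  `|u^*%C + a| < `|u - a|.
Proof.
case: u a => [x y] [a b] /= x_gt0 a_lt0.
rewrite -(ltr_pXn2r (n := 2)) ?nnegrE ?normr_ge0 //.
rewrite !sqr_normc ltcE /=.
apply/andP; split; first by apply/eqP; ring.
nra.
Qed.

(** Conjugation maps [z] to [z^-1] on the unit circle, hence this value to its
    opposite. *)
Lemma mobius_circle_Re0 (u z : R[i]) : `|z| = 1 -> z != 1 ->
  Re ((u + u^*%C * z) / (1 - z)) = 0.
Proof.
move=> z1 zN1; have z_neq0 : z != 0 by rewrite -normr_eq0 z1 oner_neq0.
have zJ : z^*%C = z^-1.
  by apply: (mulfI z_neq0); rewrite -sqr_normc z1 expr1n divff.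
set s := _ / _.
have sJ : s^*%C = - s.
  rewrite /s rmorphM rmorphD rmorphM fmorphV rmorphB rmorph1 /= conjcK zJ.
  have zB : 1 - z != 0 by rewrite subr_eq0 eq_sym.
  have zB' : z - 1 != 0 by rewrite subr_eq0.
  by field; rewrite z_neq0 zB zB'.
move/(congr1 (@complex.Re R)): sJ; case: (s) => [x y] /= xN.
by lra.
Qed.

(** The inverse [z |-> (u + u^* z) / (1 - z)] of
    [s |-> (s - u) / (u^* + s)] sends 0 to [u] and the circle without 1 to the
    imaginary axis.  The bound on the sizes makes [(1 - z)^(deg D) N] a
    polynomial in [z]. *)
Theorem half_plane_max_modulus (N D : {poly R[i]}) (g : R) :
  0 <= g -> (size N <= size D)%N ->
  (forall z, root D z -> Re z < 0) ->
  (forall w : R, `|N.[(0 +i* w)%C]| <= (g%:C)%C * `|D.[(0 +i* w)%C]|) ->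
  forall s, 0 <= Re s -> `|N.[s]| <= (g%:C)%C * `|D.[s]|.
Proof.
move=> g_ge0 size_le D_lhp axis_le [x y]; rewrite /= le_eqVlt.
move=> /orP[/eqP <-|x_gt0]; first exact: axis_le.
set u := (x +i* y)%C; pose u' := u^*%C.
have D_neq0 : D != 0.
  by apply/eqP => D0; have := D_lhp 0; rewrite D0 root0 /= ltxx => /(_ isT).
have [rs D_split] := closed_field_poly_normal D.
set c := lead_coef D in D_split.
have c_neq0 : c != 0 by rewrite lead_coef_eq0.
have size_D : size D = (size rs).+1.
  by rewrite D_split size_scale // (size_prod_XsubC _ id).
set n0 := size rs in size_D.
have rs_lhp r : r \in rs -> Re r < 0.
  by move=> r_rs; apply: D_lhp; rewrite D_split rootZ // root_prod_XsubC.
have DE z : D.[z] = c * \prod_(r <- rs) (z - r).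
  rewrite D_split hornerZ horner_prod; congr (_ * _).
  by apply: eq_bigr => r _; rewrite !hornerE.
have uB r : r \in rs -> u - r != 0.
  move=> /rs_lhp r_lt0; rewrite subr_eq0; apply/eqP => ur.
  by move: r_lt0; rewrite -ur /= => /(lt_trans x_gt0); rewrite ltxx.
have Du_neq0 : D.[u] != 0.
  by apply/negP => /D_lhp /= /(lt_trans x_gt0); rewrite ltxx.
(* (1 - z) (s z - r) = (u - r) + (u^* + r) z for each root r of D *)
pose bs := [seq - (u' + r) / (u - r) | r <- rs].
have bs_lt1 : all (fun b => `|b| < 1) bs.
  apply/allP => _ /mapP[r r_rs ->].
  rewrite normrM normrN normfV ltr_pdivrMr ?normr_gt0 ?uB // mul1r.
  by apply: lhp_reflection_lt => //; apply: rs_lhp.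
pose n : {poly R[i]} := D.[u]^-1 *: \sum_(k < n0.+1)
   N`_k *: ((u%:P + u' *: 'X) ^+ k * (1 - 'X) ^+ (n0 - k)).
pose s z := (u + u' * z) / (1 - z).
have nE z : z != 1 -> n.[z] = (1 - z) ^+ n0 * N.[s z] / D.[u].
  move=> zN1; have zB : 1 - z != 0 by rewrite subr_eq0 eq_sym.
  rewrite hornerZ mulrC; congr (_ / _).
  rewrite [N.[_]](@horner_coef_wide _ n0.+1) ?(leq_trans size_le) ?size_D //.
  rewrite horner_sum mulr_sumr; apply: eq_bigr => k _.
  rewrite hornerZ mulrCA; congr (_ * _).
  rewrite hornerM !horner_exp !hornerE /s expr_div_n.
  by rewrite mulrCA -expfB_cond // (negPf zB) add0n -ltnS.
have DsE z : z != 1 ->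
    (1 - z) ^+ n0 * D.[s z] = D.[u] * \prod_(b <- bs) (1 - b * z).
  move=> zN1; have zB : 1 - z != 0 by rewrite subr_eq0 eq_sym.
  rewrite !DE mulrCA -mulrA; congr (_ * _).
  rewrite big_map -big_split /= /n0.
  have -> : (1 - z) ^+ size rs = \prod_(r <- rs) (1 - z).
    by rewrite big_const_seq count_predT iter_mulr_1.
  rewrite -big_split /= big_seq [RHS]big_seq; apply: eq_bigr => r /uB uBr.
  by rewrite /s; field; rewrite zB uBr.
have n0E : n.[0] = N.[u] / D.[u].
  by rewrite nE 1?eq_sym ?oner_neq0 // subr0 expr1n mul1r /s mulr0 addr0 subr0 divr1.
suff : `|n.[0]| <= (g%:C)%C.
  by rewrite n0E normf_div ler_pdivrMr ?normr_gt0.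
apply: (disc_max_modulus g_ge0 bs_lt1) => z z1 zN1.
have sE : s z = (0 +i* Im (s z))%C.
  by have := mobius_circle_Re0 u z1 zN1; rewrite -/(s z); case: (s z) => a b /= ->.
rewrite nE // normf_div ler_pdivrMr ?normr_gt0 // -mulrA -normrM.
rewrite [_ * D.[u]]mulrC -DsE // !normrM mulrCA ler_wpM2l ?normr_ge0 //.
by rewrite sE; apply: axis_le.
Qed.

End HalfPlaneMaximumModulus.

(** * The largest singular value bounds the numerical range *)

Section LargestSingularValue.
Variables (R : realType) (m n : nat) (M : 'M[R[i]]_(m, n)).

Let H := M^t* *m M.

Let H_selfadjoint : H^t* = H.
Proof. by rewrite /H trmx_mul map_mxM trmxCK. Qed.

Lemma adjoint_mul_self_ge0 k (v : 'cV[R[i]]_k) : 0 <= (v^t* *m v) 0 0.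
Proof. by rewrite mxE sumr_ge0 // => i _; rewrite !mxE mulrC mul_conjC_ge0. Qed.

(** The squares are roots of one characteristic polynomial.  Without this
    bound [sup] would say nothing about the individual singular values. *)
Lemma singular_values_has_ubound : has_ubound (singular_values M).
Proof.
have p_neq0 : char_poly H != 0 by apply: monic_neq0; apply: char_poly_monic.
have [b b_ub] := Cauchy_root_bound p_neq0.
exists (1 + complex.Re b) => s [s_ge0]; rewrite eigenvalue_root_char => /b_ub.
rewrite ger0_norm ?ler0c ?exprn_ge0 // lecE /= => /andP[_ s2_le].
by nra.
Qed.

Lemma sigma_max_ge0 : 0 <= sigma_max M.
Proof.
have [/set0P[s sv_s]|/negPn/eqP sv0] := boolP (singular_values M != set0).
  apply: le_trans (ub_le_sup singular_values_has_ubound sv_s).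
  by case: sv_s.
by rewrite /sigma_max sv0 sup0.
Qed.

Lemma eigenvalue_le_sigma_max (a : R[i]) : eigenvalue H a ->
  a <= ((sigma_max M ^+ 2)%:C)%C.
Proof.
move=> Ha; have /eigenvalueP[x xH x_neq0] := Ha.
have x2_gt0 : 0 < (x *m x^t*) 0 0 by rewrite -dotmxE dnorm_gt0.
have a_ge0 : 0 <= a.
  rewrite -(pmulr_lge0 _ x2_gt0).
  have -> : a * (x *m x^t*) 0 0 = ((M *m x^t*)^t* *m (M *m x^t*)) 0 0.
    rewrite trmx_mul map_mxM trmxCK mulmxA -(mulmxA x) -/H xH -scalemxAl.
    by rewrite [RHS]mxE.
  exact: adjoint_mul_self_ge0.
have [t t_ge0 aE] : exists2 t : R, 0 <= t & a = (t%:C)%C.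
  exists (complex.Re a); move: a_ge0; rewrite lecE /= => /andP[/eqP Im0 //].
  by case: (a) Im0 => ? ? /= ->.
have s_sv : singular_values M (Num.sqrt t).
  split; first exact: sqrtr_ge0.
  by rewrite (sqr_sqrtr t_ge0) -aE.
have s_le : Num.sqrt t <= sigma_max M.
  exact: (ub_le_sup singular_values_has_ubound).
rewrite aE lecR -(sqr_sqrtr t_ge0) ler_sqr ?nnegrE ?sqrtr_ge0 //.
exact: le_trans (sqrtr_ge0 _) s_le.
Qed.

(** In a unitary eigenbasis of [M^* M] both sides are weighted sums of squared
    moduli of coordinates, and the weights on the left are eigenvalues. *)
Lemma mulmx_norm_le_sigma_max (v : 'cV[R[i]]_n) :
  ((M *m v)^t* *m (M *m v)) 0 0 <=
  ((sigma_max M ^+ 2)%:C)%C * (v^t* *m v) 0 0.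
Proof.
have Hnormal : H \is normalmx by apply/normalmxP; rewrite H_selfadjoint.
have /orthomx_spectralP := Hnormal.
set P := spectralmx H; set d := spectral_diag H => HE.
have PU : P \is unitarymx := spectral_unitarymx H.
have PK : P^t* *m P = 1%:M by rewrite -invmx_unitary ?mulVmx ?spectral_unit.
have d_eigen i : eigenvalue H (d 0 i).
  apply/eigenvalueP; exists (row i P).
    rewrite HE !mulmxA -row_mul mulmxV ?spectral_unit // row1.
    by rewrite -rowE row_diag_mx -scalemxAl -rowE.
  apply/eqP => Pi0; have /row_unitarymxP/(_ i i) := PU.
  by rewrite Pi0 linear0l eqxx => /esym/eqP; rewrite oner_eq0.
pose w := P *m v.
have -> : v^t* *m v = w^t* *m w.
  by rewrite /w trmx_mul map_mxM mulmxA -(mulmxA _ _ P) PK mulmx1.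
have -> : (M *m v)^t* *m (M *m v) = w^t* *m (diag_mx d *m w).
  rewrite trmx_mul map_mxM mulmxA -(mulmxA _ _ M) -/H HE invmx_unitary //.
  by rewrite /w trmx_mul map_mxM !mulmxA.
rewrite mul_diag_mx !mxE mulr_sumr; apply: ler_sum => i _.
rewrite !mxE mulrCA; apply: ler_wpM2r; first by rewrite mulrC mul_conjC_ge0.
exact: eigenvalue_le_sigma_max.
Qed.

End LargestSingularValue.

(** Cauchy-Schwarz turns the operator norm bound into one on the scalar
    function to which the maximum modulus principle is applied. *)
Lemma numerical_range_le_sigma_max (R : realType) n (M : 'M[R[i]]_n) (v : 'cV_n) :
  `|(v^t* *m M *m v) 0 0| <= ((sigma_max M)%:C)%C * (v^t* *m v) 0 0.
Proof.
have s_ge0 : 0 <= sigma_max M by apply: sigma_max_ge0.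
have v2_ge0 := adjoint_mul_self_ge0 v.
rewrite -(ler_pXn2r (n := 2)) ?nnegrE ?normr_ge0 ?mulr_ge0 ?ler0c //.
have cs (x y : 'rV[R[i]]_n) : `|(x *m y^t*) 0 0| ^+ 2 <=
    (x *m x^t*) 0 0 * (y *m y^t*) 0 0.
  by rewrite -!dotmxE; case: (CauchySchwarz (@dotmx _ n) x y).
have := cs (v^t*) ((M *m v)^t*); rewrite !trmxCK mulmxA => /le_trans; apply.
rewrite exprMn [X in _ <= _ * X]expr2 mulrA [leRHS]mulrC.
apply: ler_wpM2l => //; rewrite -rmorphXn; exact: mulmx_norm_le_sigma_max.
Qed.

(** * Rational functions without poles in the closed right half-plane *)

Section LhpRationalFunctions.
Variable R : realType.
Local Notation RtoC := (real_complex R).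
Local Notation "p %:F" := (poly_ratfun R p).

Definition hurwitz_poly (D : {poly R}) : Prop :=
  forall z, root (map_poly RtoC D) z -> complex.Re z < 0.

Lemma hurwitz_poly_neq0 D : hurwitz_poly D -> D != 0.
Proof.
move=> hD; apply/eqP => D0; have := hD 0.
by rewrite D0 rmorph0 root0 /= ltxx => /(_ isT).
Qed.

Lemma hurwitz_poly1 : hurwitz_poly 1.
Proof. by move=> z; rewrite rmorph1 (negPf (root1 _)). Qed.

Lemma hurwitz_polyM D E : hurwitz_poly D -> hurwitz_poly E -> hurwitz_poly (D * E).
Proof. by move=> hD hE z; rewrite rmorphM rootM => /orP[/hD|/hE]. Qed.

Lemma hurwitz_poly_factor D E : hurwitz_poly (D * E) -> hurwitz_poly E.
Proof. by move=> hDE z zE; apply: hDE; rewrite rmorphM rootM zE orbT. Qed.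

Lemma hurwitz_poly_prod (I : Type) (r : seq I) (D : I -> {poly R}) :
  (forall i, hurwitz_poly (D i)) -> hurwitz_poly (\prod_(i <- r) D i).
Proof.
move=> hD; elim/big_rec: _ => [|i E _]; first exact: hurwitz_poly1.
exact: hurwitz_polyM.
Qed.

Lemma hurwitzE n (M : 'M[R]_n) : hurwitz M <-> hurwitz_poly (char_poly M).
Proof.
by split=> hM z; have := hM z; rewrite eigenvalue_root_char -map_char_poly.
Qed.

(** Properness is left out on purpose: the ring must contain the variable [s],
    and the inverse in the small-gain argument is then stable as soon as a
    determinant has no root in the closed right half-plane, whatever happens
    at infinity. *)
Definition lhp_ratfun : {pred ratfun R} :=
  fun f => `[< exists N D, hurwitz_poly D /\ f = N%:F / D%:F >].

Lemma lhp_ratfunP f :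
  reflect (exists N D, hurwitz_poly D /\ f = N%:F / D%:F) (f \in lhp_ratfun).
Proof. exact: asboolP. Qed.

Lemma lhp_ratfun_poly N : N%:F \in lhp_ratfun.
Proof.
apply/lhp_ratfunP; exists N, 1; split; first exact: hurwitz_poly1.
by rewrite tofrac1 divr1.
Qed.

Lemma lhp_ratfunV D : hurwitz_poly D -> (D%:F)^-1 \in lhp_ratfun.
Proof. by move=> hD; apply/lhp_ratfunP; exists 1, D; rewrite tofrac1 mul1r. Qed.

Lemma lhp_ratfun_subring : subring_closed lhp_ratfun.
Proof.
split=> [|_ _ /lhp_ratfunP[N [D [hD ->]]] /lhp_ratfunP[M [E [hE ->]]]|
          _ _ /lhp_ratfunP[N [D [hD ->]]] /lhp_ratfunP[M [E [hE ->]]]].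
- by rewrite -tofrac1 lhp_ratfun_poly.
- apply/lhp_ratfunP; exists (N * E - M * D), (D * E).
  split; first exact: hurwitz_polyM.
  by rewrite tofracB !tofracM -mulNr addf_div ?mulNr // tofrac_eq0 hurwitz_poly_neq0.
- apply/lhp_ratfunP; exists (N * M), (D * E).
  by split; [exact: hurwitz_polyM|rewrite !tofracM mulf_div].
Qed.

HB.instance Definition _ :=
  GRing.isSubringClosed.Build (ratfun R) lhp_ratfun lhp_ratfun_subring.

Lemma ratmx_of_lhp m n (M : 'M[R]_(m, n)) : ratmx_of M \is a mxOver lhp_ratfun.
Proof. by apply/mxOverP => i j; rewrite mxE lhp_ratfun_poly. Qed.

Lemma map_tofrac_lhp m n (P : 'M[{poly R}]_(m, n)) :
  map_mx (poly_ratfun R) P \is a mxOver lhp_ratfun.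
Proof. by apply/mxOverP => i j; rewrite mxE lhp_ratfun_poly. Qed.

Lemma map_tofrac_unit n (P : 'M[{poly R}]_n) :
  (map_mx (poly_ratfun R) P \in unitmx) = (\det P != 0).
Proof. by rewrite unitmxE det_map_mx unitfE tofrac_eq0. Qed.

(** Cramer: the determinant is the only denominator. *)
Lemma invmx_lhp n (P : 'M[{poly R}]_n) : hurwitz_poly (\det P) ->
  invmx (map_mx (poly_ratfun R) P) \is a mxOver lhp_ratfun.
Proof.
move=> hP; rewrite /invmx map_tofrac_unit hurwitz_poly_neq0 //.
rewrite det_map_mx -map_mx_adj; apply: mxOverZ; first exact: lhp_ratfunV.
exact: map_tofrac_lhp.
Qed.

Lemma rfden_neq0 (f : ratfun R) : rfden f != 0.
Proof.
rewrite /rfden divpN0 ?dvdp_leq ?dvdp_gcdr ?denom_ratioP //.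
by rewrite gcdp_eq0 negb_and denom_ratioP orbT.
Qed.

(** Cancelling the gcd in the arbitrary representative does not change the
    fraction. *)
Lemma rfnum_rfden (f : ratfun R) : f = (rfnum f)%:F / (rfden f)%:F.
Proof.
set n := \n_(repr f); set d := \d_(repr f).
have d_neq0 : d != 0 by exact: denom_ratioP.
have g_neq0 : gcdp n d != 0 by rewrite gcdp_eq0 negb_and d_neq0 orbT.
have fE : f * d%:F = n%:F.
  rewrite -[f in LHS]reprK !piE /FracField.mulf; apply/eqmodP.
  rewrite /= FracField.equivfE !numden_Ratio ?mulf_neq0 ?oner_eq0 //.
  by rewrite !mulr1 mulrC.
apply: (mulIf (x := d%:F)); first by rewrite tofrac_eq0.
rewrite fE -[in RHS](divpK (dvdp_gcdr n d)) -/(rfden f) tofracM mulrA divfK.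
  by rewrite -tofracM divpK ?dvdp_gcdl.
by rewrite tofrac_eq0 rfden_neq0.
Qed.

Lemma RHinf_lhp m n (F : 'M[ratfun R]_(m, n)) :
  RHinf F -> F \is a mxOver lhp_ratfun.
Proof.
move=> hF; apply/mxOverP => i j; apply/lhp_ratfunP.
exists (rfnum (F i j)), (rfden (F i j)); split; last exact: rfnum_rfden.
by case: (hF i j).
Qed.

(** The frequency responses are bounded uniformly away from 1, which the
    supremum being less than 1 gives and pointwise bounds would not. *)
Lemma Hinf_norm_lt1 m n (F : 'M[ratfun R]_(m, n)) :
  (Hinf_norm F < 1%:E)%E -> RHinf F /\
    exists2 g : R, 0 <= g < 1 &
      forall w : R, sigma_max (map_mx (rfeval (0 +i* w)%C) F) <= g.
Proof.
rewrite /Hinf_norm; case: asboolP => // hF; set S := [set _ | w in _]%classic.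
move=> supS_lt1; split=> //; pose s w := sigma_max (map_mx (rfeval (0 +i* w)%C) F).
have s_le w : ((s w)%:E <= ereal_sup S)%E by apply: ereal_sup_ubound; exists w.
case: (ereal_sup S) supS_lt1 s_le => [g| |] //.
  rewrite lte_fin => g_lt1 s_le; exists g => [|w]; last first.
    by have := s_le w; rewrite lee_fin.
  rewrite g_lt1 andbT; have := s_le 0; rewrite lee_fin; apply: le_trans.
  exact: sigma_max_ge0.
by move=> _ /(_ 0).
Qed.

End LhpRationalFunctions.

(** * Small gain *)

Section SmallGain.
Variable R : realType.
Local Notation RtoC := (real_complex R).
Local Notation "p %:F" := (poly_ratfun R p).

(** The size bound is properness, kept entry by entry when passing to the
    common denominator; it is what the maximum modulus principle requires of a
    numerator. *)
Lemma RHinf_common_denominator m n (F : 'M[ratfun R]_(m, n)) : RHinf F ->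
  exists (N : 'M[{poly R}]_(m, n)) (D : {poly R}),
    [/\ hurwitz_poly D, forall i j, (size (N i j) <= size D)%N,
        map_mx (poly_ratfun R) N = D%:F *: F &
        forall z, 0 <= complex.Re z ->
          map_mx (fun p => (map_poly RtoC p).[z]) N =
          (map_poly RtoC D).[z] *: map_mx (rfeval z) F].
Proof.
move=> hF; pose D := \prod_i \prod_j rfden (F i j).
have den_hurwitz i j : hurwitz_poly (rfden (F i j)) by case: (hF i j).
have D_hurwitz : hurwitz_poly D.
  by apply: hurwitz_poly_prod => i; apply: hurwitz_poly_prod => j.
have D_neq0 := hurwitz_poly_neq0 D_hurwitz.
have den_dvd i j : rfden (F i j) %| D.
  by rewrite /D (bigD1 i) //= (bigD1 j) //= -mulrA dvdp_mulr.
pose Q i j := D %/ rfden (F i j).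
have DE i j : D = Q i j * rfden (F i j) by rewrite divpK.
exists (\matrix_(i, j) (rfnum (F i j) * Q i j)), D; split => //.
- move=> i j; rewrite mxE [in leqRHS](DE i j).
  have Q_neq0 : Q i j != 0.
    by apply: contraNneq D_neq0 => Q0; rewrite (DE i j) Q0 mul0r.
  rewrite (size_mul Q_neq0 (rfden_neq0 _)) [X in (_ <= X.-1)%N]addnC.
  apply: leq_trans (size_polyMleq _ _) _.
  by rewrite -!subn1 leq_sub2r // leq_add2r; case: (hF i j).
- apply/matrixP => i j; rewrite !mxE (DE i j) {3}(rfnum_rfden (F i j)) !tofracM.
  by rewrite -mulrA [X in _ = _ * X]mulrC divfK ?tofrac_eq0 ?rfden_neq0 // mulrC.
- move=> z z_ge0; apply/matrixP => i j.
  rewrite !mxE (DE i j) !rmorphM !hornerM /rfeval.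
  have den_neq0 : (map_poly RtoC (rfden (F i j))).[z] != 0.
    by apply/negP => /den_hurwitz; rewrite ltNge z_ge0.
  by rewrite -mulrA [X in _ = _ * X]mulrC divfK // mulrC.
Qed.

(** Since [I - F = D^-1 (D I - N)], the only possible poles of its inverse are
    the roots of [det (D I - N)].  At such a root [s] some [v] satisfies
    [N(s) v = D(s) v], so the polynomials [f = v^* N v] and [d = (v^* v) D]
    agree at [s], while [|f| <= g |d|] on the imaginary axis. *)
Theorem small_gain n (F : 'M[ratfun R]_n) :
  (Hinf_norm F < 1%:E)%E ->
  exists2 Y, Y \is a mxOver (@lhp_ratfun R) & Y *m (1%:M - F) = 1%:M.
Proof.
move=> /Hinf_norm_lt1[hF [g /andP[g_ge0 g_lt1] sigma_le]].
have [N [D [D_hurwitz size_le NE N_eval]]] := RHinf_common_denominator hF.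
pose P := D%:M - N.
have PE : map_mx (poly_ratfun R) P = D%:F *: (1%:M - F).
  by rewrite map_mxB map_scalar_mx NE scalerBr scalemx1.
suff P_hurwitz : hurwitz_poly (\det P).
  exists (D%:F *: invmx (map_mx (poly_ratfun R) P)).
    by apply: mxOverZ; [exact: lhp_ratfun_poly|exact: invmx_lhp].
  rewrite -scalemxAl scalemxAr -PE mulVmx //.
  by rewrite map_tofrac_unit hurwitz_poly_neq0.
move=> s s_root; rewrite ltNge; apply/negP => s_ge0.
pose evalC z (p : {poly R}) := (map_poly RtoC p).[z].
have [v v_neq0 Pv] : exists2 v : 'cV[R[i]]_n,
    v != 0 & map_mx (evalC s) N *m v = evalC s D *: v.
  have : \det (map_mx (horner_eval s \o map_poly RtoC) P)^T == 0.
    by rewrite det_tr det_map_mx.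
  move=> /det0P[x x_neq0] /(congr1 trmx).
  rewrite trmx_mul !trmxK trmx0 => Px; exists x^T.
    by rewrite -(inj_eq (@trmx_inj _ _ _)) trmxK trmx0.
  apply/eqP; rewrite eq_sym -subr_eq0; apply/eqP; rewrite -Px.
  rewrite -mul_scalar_mx -mulmxBl; congr (_ *m _).
  apply/matrixP => i j; rewrite !mxE /= /horner_eval rmorphB hornerD hornerN.
  by rewrite /evalC rmorphMn hornerMn.
pose v2 := (v^t* *m v) 0 0.
have v2_gt0 : 0 < v2.
  have := dnorm_gt0 (@dotmx _ n) (v^t*); rewrite /= dotmxE trmxCK => ->.
  apply: contra v_neq0 => /eqP v0.
  by rewrite -[v]trmxCK v0 trmx0 map_mx0.
pose f : {poly R[i]} :=
  \sum_i \sum_j (((v^t*) 0 i * v j 0) *: map_poly RtoC (N i j)).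
have fE z : f.[z] = (v^t* *m map_mx (evalC z) N *m v) 0 0.
  rewrite -mulmxA mxE horner_sum; apply: eq_bigr => i _.
  rewrite [X in _ = _ * X]mxE horner_sum mulr_sumr; apply: eq_bigr => j _.
  by rewrite hornerZ [map_mx _ N i j]mxE -mulrA [v j 0 * _]mulrC.
pose d := v2 *: map_poly RtoC D.
have dE z : d.[z] = v2 * evalC z D by rewrite hornerZ.
have f_size : (size f <= size d)%N.
  rewrite size_scale ?gt_eqF // size_map_poly.
  apply: leq_trans (size_sum _ _ _) _; apply/bigmax_leqP => i _.
  apply: leq_trans (size_sum _ _ _) _; apply/bigmax_leqP => j _.
  by apply: leq_trans (size_scale_leq _ _) _; rewrite size_map_poly.
have d_lhp z : root d z -> complex.Re z < 0.
  by rewrite rootZ ?gt_eqF //; apply: D_hurwitz.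
have fd_axis w : `|f.[(0 +i* w)%C]| <= (g%:C)%C * `|d.[(0 +i* w)%C]|.
  set z := (0 +i* w)%C; rewrite fE dE N_eval //.
  rewrite -scalemxAr -scalemxAl mxE !normrM mulrA [leRHS]mulrC.
  apply: ler_wpM2l => //.
  apply: le_trans (numerical_range_le_sigma_max _ _) _.
  rewrite (gtr0_norm v2_gt0); apply: ler_wpM2r; first exact: ltW.
  by rewrite lecR; apply: sigma_le.
have := half_plane_max_modulus g_ge0 f_size d_lhp fd_axis s_ge0.
have -> : f.[s] = d.[s].
  by rewrite fE dE -mulmxA Pv -scalemxAr mxE mulrC.
have ds_gt0 : 0 < `|d.[s]|.
  by rewrite normr_gt0; apply/negP => /d_lhp; rewrite ltNge s_ge0.
by rewrite ler_pMl // -[1]/((1%:C)%C) lecR leNgt g_lt1.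
Qed.

End SmallGain.

(** * Cancelling input and output matrices of a minimal realization *)

Section MinimalRealizations.
Variable R : realType.
Local Notation T := (mxOver (@lhp_ratfun R)).
Local Notation sI_minus M := (map_mx (poly_ratfun R) (char_poly_mx M)).

Lemma lhp_mulmx m n p (M : 'M[ratfun R]_(m, n)) (N : 'M[ratfun R]_(n, p)) :
  M \is a T -> N \is a T -> M *m N \is a T.
Proof. exact: mxOverM. Qed.

Lemma ratmx_ofM m n p (M : 'M[R]_(m, n)) (N : 'M[R]_(n, p)) :
  ratmx_of (M *m N) = ratmx_of M *m ratmx_of N.
Proof. exact: map_mxM. Qed.

Lemma ratmx_of1 n : ratmx_of (1%:M : 'M[R]_n) = 1%:M.
Proof. exact: map_mx1. Qed.

Lemma sI_minusE n (A : 'M[R]_n) :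
  sI_minus A = (poly_ratfun R 'X)%:M - ratmx_of A.
Proof. by rewrite map_mxB map_scalar_mx -map_mx_comp. Qed.

Lemma sI_minus_unit n (A : 'M[R]_n) : sI_minus A \in unitmx.
Proof. by rewrite map_tofrac_unit monic_neq0 // char_poly_monic. Qed.

(** Full column rank of the observability matrix provides [L_i] with
    [sum L_i C A^i = I], hence [X = sum L_i (C A^i X)], and
    [C A^(i+1) X = s C A^i X - C A^i (sI - A) X]. *)
Lemma observable_lhp n p k (A : 'M[R]_n) (C : 'M[R]_(p, n))
    (X : 'M[ratfun R]_(n, k)) : observable C A ->
  ratmx_of C *m X \is a T -> sI_minus A *m X \is a T -> X \is a T.
Proof.
move=> obs CX AX.
have CAX i : ratmx_of (C *m A ^+ i) *m X \is a T.
  elim: i => [|i IH]; first by rewrite expr0 mulmx1.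
  have -> : ratmx_of (C *m A ^+ i.+1) *m X =
      poly_ratfun R 'X *: (ratmx_of (C *m A ^+ i) *m X) -
      ratmx_of (C *m A ^+ i) *m (sI_minus A *m X).
    have -> : C *m A ^+ i.+1 = C *m A ^+ i *m A by rewrite exprSr -mulmxA.
    rewrite ratmx_ofM sI_minusE mulmxBl mul_scalar_mx mulmxBr.
    by rewrite -scalemxAr opprB addrC subrK mulmxA.
  by apply: rpredB; [apply: mxOverZ; rewrite ?lhp_ratfun_poly|
                     rewrite mxOverM ?ratmx_of_lhp].
have /row_fullP[L LE] : row_full (\mxcol_(i < n) (C *m A ^+ i)).
  by rewrite /row_full obs.
rewrite -[L]submxrowK mul_mxrow_mxcol in LE.
rewrite -[X]mul1mx -ratmx_of1 -LE /ratmx_of raddf_sum /= mulmx_suml.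
apply: rpred_sum => i _; rewrite -/(ratmx_of _) ratmx_ofM -mulmxA.
by apply: mxOverM; [exact: ratmx_of_lhp|exact: CAX].
Qed.

(** The dual of [observable_lhp]. *)
Lemma controllable_lhp n m k (A : 'M[R]_n) (B : 'M[R]_(n, m))
    (X : 'M[ratfun R]_(k, n)) : controllable A B ->
  X *m ratmx_of B \is a T -> X *m sI_minus A \is a T -> X \is a T.
Proof.
move=> ctr XB XA.
have XAB i : X *m ratmx_of (A ^+ i *m B) \is a T.
  elim: i => [|i IH]; first by rewrite expr0 mul1mx.
  have -> : X *m ratmx_of (A ^+ i.+1 *m B) =
      poly_ratfun R 'X *: (X *m ratmx_of (A ^+ i *m B)) -
      (X *m sI_minus A) *m ratmx_of (A ^+ i *m B).
    have -> : A ^+ i.+1 *m B = A *m (A ^+ i *m B) by rewrite exprS mulmxA.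
    rewrite ratmx_ofM sI_minusE mulmxBr mul_mx_scalar mulmxBl.
    by rewrite -scalemxAl opprB addrC subrK mulmxA.
  by apply: rpredB; [apply: mxOverZ; rewrite ?lhp_ratfun_poly|
                     rewrite mxOverM ?ratmx_of_lhp].
have /row_freeP[L LE] : row_free (\mxrow_(i < n) (A ^+ i *m B)).
  by rewrite /row_free ctr.
rewrite -[L]submxcolK mul_mxrow_mxcol in LE.
rewrite -[X]mulmx1 -ratmx_of1 -LE /ratmx_of raddf_sum /= mulmx_sumr.
apply: rpred_sum => i _; rewrite -/(ratmx_of _) ratmx_ofM mulmxA.
by apply: mxOverM; [exact: XAB|exact: ratmx_of_lhp].
Qed.

(** For the converse, [1 / char_poly M = N / D] with [D] Hurwitz gives
    [D = N * char_poly M], so the roots of [char_poly M] are among those of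
    [D]. *)
Lemma resolvent_lhp n (M : 'M[R]_n) : hurwitz M <-> invmx (sI_minus M) \is a T.
Proof.
rewrite hurwitzE; split=> [|PhiT]; first exact: invmx_lhp.
have : \det (invmx (sI_minus M)) \in @lhp_ratfun R.
  rewrite /determinant; apply: rpred_sum => s _; rewrite rpredM ?rpred_sign //.
  by apply: rpred_prod => i _; apply: (mxOverP PhiT).
rewrite det_inv det_map_mx => /lhp_ratfunP[N [D [D_hurwitz detE]]].
have chi_neq0 : char_poly M != 0 by rewrite monic_neq0 // char_poly_monic.
have DE : D = N * char_poly M.
  apply/eqP; rewrite -tofrac_eq tofracM; apply/eqP.
  apply: (mulfI (x := (poly_ratfun R (char_poly M))^-1)).
    by rewrite invr_eq0 tofrac_eq0.
  rewrite [in RHS]mulrC mulfK ?tofrac_eq0 // detE divfK //.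
  by rewrite tofrac_eq0 hurwitz_poly_neq0.
by move: D_hurwitz; rewrite DE => /hurwitz_poly_factor.
Qed.

End MinimalRealizations.

(** * The closed loop *)

Section ClosedLoop.
Variables (R : realType) (n m p q : nat).
Variables (A : 'M[R]_n) (B : 'M[R]_(n, m)) (C : 'M[R]_(p, n)).
Variables (AK : 'M[R]_q) (BK : 'M[R]_(q, p)) (CK : 'M[R]_(m, q)).
Local Notation T := (mxOver (@lhp_ratfun R)).
Local Notation sI_minus M := (map_mx (poly_ratfun R) (char_poly_mx M)).

Let G := transfer A B C.
Let K := transfer AK BK CK.
Let S := invmx (1%:M - G *m K).

Let b := ratmx_of B.
Let c := ratmx_of C.
Let bK := ratmx_of BK.
Let cK := ratmx_of CK.
Let sA := sI_minus A.
Let sK := sI_minus AK.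

Let M := block_mx A (B *m CK) (BK *m C) AK.
Let Phi := invmx (sI_minus M).
Let X11 := ulsubmx Phi.
Let X12 := ursubmx Phi.
Let X21 := dlsubmx Phi.
Let X22 := drsubmx Phi.

Lemma sI_minus_closed_loop :
  sI_minus M = block_mx sA (- (b *m cK)) (- (bK *m c)) sK.
Proof.
rewrite sI_minusE scalar_mx_block /ratmx_of map_block_mx opp_block_mx add_block_mx.
by rewrite -!/(ratmx_of _) !ratmx_ofM !add0r /sA /sK !sI_minusE.
Qed.

Lemma closed_loop_resolvent_right :
  [/\ sA *m X11 = 1%:M + b *m (cK *m X21), sA *m X12 = b *m (cK *m X22),
      sK *m X21 = bK *m (c *m X11) & sK *m X22 = 1%:M + bK *m (c *m X12)].
Proof.
have : sI_minus M *m Phi = 1%:M by rewrite mulmxV ?sI_minus_unit.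
rewrite sI_minus_closed_loop -[Phi]submxK mulmx_block scalar_mx_block !mulNmx.
rewrite -!mulmxA => /eq_block_mx[e11 e12 e21 e22]; split.
- by rewrite -e11 subrK.
- by apply/eqP; rewrite -subr_eq0 e12.
- by apply/eqP; rewrite -subr_eq0 addrC e21.
- by rewrite -e22 addrC addNKr.
Qed.

Lemma closed_loop_resolvent_left :
  [/\ X11 *m sA = 1%:M + X12 *m bK *m c, X12 *m sK = X11 *m b *m cK,
      X21 *m sA = X22 *m bK *m c & X22 *m sK = 1%:M + X21 *m b *m cK].
Proof.
have : Phi *m sI_minus M = 1%:M by rewrite mulVmx ?sI_minus_unit.
rewrite sI_minus_closed_loop -[Phi]submxK mulmx_block scalar_mx_block !mulmxN.
rewrite !mulmxA => /eq_block_mx[e11 e12 e21 e22]; split.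
- by rewrite -e11 subrK.
- by apply/eqP; rewrite -subr_eq0 addrC e12.
- by apply/eqP; rewrite -subr_eq0 e21.
- by rewrite -e22 addrC addNKr.
Qed.

(** Let [Hij] be the block [Xij] of the resolvent with the output matrix on its
    left and the input matrix on its right.  The block equations give [H11 =
    G + G H21], [H12 = G H22], [H21 = K H11] and [H22 = K + K H12]; hence
    [I + H12] inverts [I - G K], for stabilizing and other controllers alike. *)
Lemma closed_loop_transfers :
  [/\ 1%:M - G *m K \in unitmx, c *m X11 *m b = S *m G,
      c *m X12 *m bK = S - 1%:M, cK *m X21 *m b = K *m S *m G &
      cK *m X22 *m bK = K *m S].
Proof.
have [e11 e12 e21 e22] := closed_loop_resolvent_right.
have sA_unit : sA \in unitmx := sI_minus_unit A.
have sK_unit : sK \in unitmx := sI_minus_unit AK.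
have h11 : c *m X11 *m b = G + G *m (cK *m X21 *m b).
  rewrite -[X11](mulKmx sA_unit) e11 mulmxDr mulmx1 mulmxDr mulmxDl.
  by rewrite /G /transfer !mulmxA.
have h12 : c *m X12 *m bK = G *m (cK *m X22 *m bK).
  by rewrite -[X12](mulKmx sA_unit) e12 /G /transfer !mulmxA.
have h21 : cK *m X21 *m b = K *m (c *m X11 *m b).
  by rewrite -[X21](mulKmx sK_unit) e21 /K /transfer !mulmxA.
have h22 : cK *m X22 *m bK = K + K *m (c *m X12 *m bK).
  rewrite -[X22](mulKmx sK_unit) e22 mulmxDr mulmx1 mulmxDr mulmxDl.
  by rewrite /K /transfer !mulmxA.
set H12 := c *m X12 *m bK in h12 h22 *.
have SE : (1%:M - G *m K) *m (1%:M + H12) = 1%:M.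
  rewrite mulmxDr mulmx1 mulmxBl mul1mx -(mulmxA G K).
  have -> : H12 - G *m (K *m H12) = G *m K.
    by rewrite {1}h12 h22 mulmxDr addrK.
  by rewrite subrK.
have [GK_unit _] := mulmx1_unit SE.
have S1 : 1%:M + H12 = S by rewrite -[LHS](mulKmx GK_unit) SE mulmx1.
have SG : c *m X11 *m b = S *m G.
  rewrite -[LHS](mulKmx GK_unit) mulmxBl mul1mx -/S; congr (_ *m _).
  by rewrite {1}h11 h21 mulmxA addrK.
split=> //.
- by rewrite -S1 addrC addKr.
- by rewrite h21 SG mulmxA.
- by rewrite h22 -S1 mulmxDr mulmx1.
Qed.

Lemma internally_stabilizes_lhp : internally_stabilizes AK BK CK A B C ->
  [/\ S *m G \is a T, S \is a T, K *m S *m G \is a T & K *m S \is a T].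
Proof.
move=> /resolvent_lhp PhiT; have [_ <- S1 <- <-] := closed_loop_transfers.
have X11T : X11 \is a T by apply/mxOverP => i j; rewrite !mxE (mxOverP PhiT).
have X12T : X12 \is a T by apply/mxOverP => i j; rewrite !mxE (mxOverP PhiT).
have X21T : X21 \is a T by apply/mxOverP => i j; rewrite !mxE (mxOverP PhiT).
have X22T : X22 \is a T by apply/mxOverP => i j; rewrite !mxE (mxOverP PhiT).
split; rewrite ?mxOverM ?ratmx_of_lhp //.
rewrite -(subrK 1%:M S) -S1 rpredD ?mxOverM ?ratmx_of_lhp //.
by rewrite mxOver_scalar ?rpred0 ?rpred1.
Qed.

(** The right resolvent equations and observability first strip the output
    matrices from the blocks of [Phi]; the left equations and controllability
    then strip the input matrices. *)
Lemma lhp_internally_stabilizes :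
  minimal_realization A B C -> minimal_realization AK BK CK ->
  S *m G \is a T -> S \is a T -> K *m S *m G \is a T -> K *m S \is a T ->
  internally_stabilizes AK BK CK A B C.
Proof.
move=> [ctrA obsA] [ctrK obsK]; have [_ <- S1 <- <-] := closed_loop_transfers.
move=> H11 ST H21 H22.
have oneT k : (1%:M : 'M[ratfun R]_k) \is a T.
  by rewrite mxOver_scalar ?rpred0 ?rpred1.
have H12 : c *m X12 *m bK \is a T by rewrite S1; apply: rpredB; [|exact: oneT].
have [bT cT bKT cKT] : [/\ b \is a T, c \is a T, bK \is a T & cK \is a T].
  by split; apply: ratmx_of_lhp.
have [e11 e12 e21 e22] := closed_loop_resolvent_right.
have [f11 f12 f21 f22] := closed_loop_resolvent_left.
have X11b : X11 *m b \is a T.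
  apply: (observable_lhp obsA); first by rewrite mulmxA.
  rewrite mulmxA e11 mulmxDl mul1mx -mulmxA.
  by apply: rpredD; [exact: bT|exact: lhp_mulmx].
have X12b : X12 *m bK \is a T.
  apply: (observable_lhp obsA); first by rewrite mulmxA.
  by rewrite mulmxA e12 -mulmxA; exact: lhp_mulmx.
have X21b : X21 *m b \is a T.
  apply: (observable_lhp obsK); first by rewrite mulmxA.
  by rewrite mulmxA e21 -mulmxA; exact: lhp_mulmx.
have X22b : X22 *m bK \is a T.
  apply: (observable_lhp obsK); first by rewrite mulmxA.
  rewrite mulmxA e22 mulmxDl mul1mx -mulmxA.
  by apply: rpredD; [exact: bKT|exact: lhp_mulmx].
have X11T : X11 \is a T.
  apply: (controllable_lhp ctrA); first exact: X11b.
  by rewrite f11; apply: rpredD; [exact: oneT|exact: lhp_mulmx X12b cT].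
have X12T : X12 \is a T.
  apply: (controllable_lhp ctrK); first exact: X12b.
  by rewrite f12; exact: lhp_mulmx X11b cKT.
have X21T : X21 \is a T.
  apply: (controllable_lhp ctrA); first exact: X21b.
  by rewrite f21; exact: lhp_mulmx X22b cT.
have X22T : X22 \is a T.
  apply: (controllable_lhp ctrK); first exact: X22b.
  by rewrite f22; apply: rpredD; [exact: oneT|exact: lhp_mulmx X21b cKT].
apply/resolvent_lhp; rewrite -/M -/Phi -[Phi]submxK; apply/mxOverP => i j.
rewrite !mxE; case: split => k; rewrite !mxE; case: split => l;
  by [rewrite (mxOverP X11T)|rewrite (mxOverP X12T)|
      rewrite (mxOverP X21T)|rewrite (mxOverP X22T)].
Qed.

End ClosedLoop.

(** * Perturbing the controller *)

(** [I - G K = (I - G Kr) + G Delta] gives [W = S + S G (Delta W)]; multiplied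
    by [Delta], this is a linear equation for [Delta W] that [Y] solves. *)
Lemma perturbed_loop (F : fieldType) m p (G : 'M[F]_(p, m)) (K Kr : 'M[F]_(m, p))
    (Y : 'M[F]_m) :
  let Delta := Kr - K in
  let S := invmx (1%:M - G *m K) in
  let W := invmx (1%:M - G *m Kr) in
  let E := Y *m (Delta *m S) in
  1%:M - G *m K \in unitmx -> 1%:M - G *m Kr \in unitmx ->
  Y *m (1%:M - Delta *m S *m G) = 1%:M ->
  W = S + S *m G *m E /\ Kr *m W = K *m S + K *m S *m G *m E + E.
Proof.
move=> Delta S W E GK_unit GKr_unit YE.
have GKW : (1%:M - G *m K) *m W = 1%:M + G *m (Delta *m W).
  have -> : 1%:M - G *m K = (1%:M - G *m Kr) + G *m Delta.
    by rewrite mulmxBr addrA subrK.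
  by rewrite mulmxDl mulmxV // mulmxA.
have WE : W = S + S *m G *m (Delta *m W).
  by rewrite -[LHS](mulKmx GK_unit) GKW mulmxDr mulmx1 -(mulmxA S).
have DW : Delta *m W = E.
  rewrite -[LHS]mul1mx -YE -mulmxA; congr (_ *m _).
  by rewrite mulmxBl mul1mx {1}WE mulmxDr !mulmxA addrK.
rewrite DW in WE; split=> //.
have -> : Kr = Delta + K by rewrite subrK.
by rewrite mulmxDl DW {1}WE mulmxDr !mulmxA addrC.
Qed.

Theorem theorem1 (R : realType) (nx m p q qr : nat)
  (A : 'M[R]_nx) (B : 'M[R]_(nx, m)) (C : 'M[R]_(p, nx))
  (AK : 'M[R]_q) (BK : 'M[R]_(q, p)) (CK : 'M[R]_(m, q))
  (AKr : 'M[R]_qr) (BKr : 'M[R]_(qr, p)) (CKr : 'M[R]_(m, qr))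
  (hG : minimal_realization A B C)
  (hK : minimal_realization AK BK CK)
  (hKr : minimal_realization AKr BKr CKr)
  (hstab : internally_stabilizes AK BK CK A B C) :
  let G := transfer A B C in
  let K := transfer AK BK CK in
  let Kr := transfer AKr BKr CKr in
  let Delta := (Kr - K)%R in
  let S := invmx (1%:M - G *m K)%R in
  RHinf (Delta *m S)%R ->
  (Order.max (Hinf_norm (S *m G *m Delta)%R) (Hinf_norm (Delta *m S *m G)%R)
     < 1%:E)%E ->
  internally_stabilizes AKr BKr CKr A B C.
Proof.
move=> G K Kr Delta S /RHinf_lhp DST; rewrite gt_max => /andP[_ norm_lt1].
have [/RHinf_lhp DSGT _] := Hinf_norm_lt1 norm_lt1.
have [Y YT YE] := small_gain norm_lt1.
have [SGT ST KSGT KST] := internally_stabilizes_lhp hstab.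
have [GK_unit _ _ _ _] := closed_loop_transfers A B C AK BK CK.
have [GKr_unit _ _ _ _] := closed_loop_transfers A B C AKr BKr CKr.
have [] := perturbed_loop GK_unit GKr_unit YE.
set E := Y *m _ => WE KrWE.
have ET : E \is a mxOver (@lhp_ratfun R) := lhp_mulmx YT DST.
have EGT : E *m G \is a mxOver (@lhp_ratfun R).
  by rewrite -mulmxA; exact: lhp_mulmx YT DSGT.
apply: (lhp_internally_stabilizes hG hKr); rewrite -/G -/Kr.
- rewrite WE mulmxDl -(mulmxA _ E).
  by apply: rpredD; [exact: SGT|exact: lhp_mulmx SGT EGT].
- by rewrite WE; apply: rpredD; [exact: ST|exact: lhp_mulmx SGT ET].
- rewrite KrWE !mulmxDl -(mulmxA _ E).
  apply: rpredD; last exact: EGT.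
  by apply: rpredD; [exact: KSGT|exact: lhp_mulmx KSGT EGT].
- rewrite KrWE; apply: rpredD; last exact: ET.
  by apply: rpredD; [exact: KST|exact: lhp_mulmx KSGT ET].
Qed.
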